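(* Let $n\ge 2$ and $\alpha\in(0,1)$. Then $$\{\mathrm{DQ}^{\mathrm{VaR}}_\alpha(\mathbf X):\mathbf X\in (L^0)^n\}=[0,\min\{n,1/\alpha\}]\quad\text{and}\quad \{\mathrm{DQ}^{\mathrm{ES}}_\alpha(\mathbf X):\mathbf X\in (L^1)^n\}=[0,1].$$
   Context: Let $(\Omega,\mathcal F,\mathbb P)$ be an atomless probability space. $L^0$ is the set of all random variables and $L^1$ the set of integrable random variables; a.s. equal random variables are identified. For $\alpha\in[0,1)$ and $X\in L^0$, $\mathrm{VaR}_\alpha(X)=\inf\{x\in\mathbb R:\mathbb P(X\le x)\ge 1-\alpha\}$; in particular $\mathrm{VaR}_0(X)=\operatorname{ess\,sup}X$, possibly $+\infty$. For $\alpha\in(0,1)$ and $X\in L^1$, $\mathrm{ES}_\alpha(X)=\frac1\alpha\int_0^\alpha\mathrm{VaR}_\beta(X)\,\mathrm d\beta$, and $\mathrm{ES}_0(X)=\operatorname{ess\,sup}X$. For $\rho\in\{\mathrm{VaR},\mathrm{ES}\}$, $\alpha\in(0,1)$ and $\mathbf X=(X_1,\dots,X_n)$ (in $(L^0)^n$ when $\rho=\mathrm{VaR}$, in $(L^1)^n$ when $\rho=\mathrm{ES}$), the diversification quotient is $\mathrm{DQ}^\rho_\alpha(\mathbf X)=\alpha^*/\alpha$, where $\alpha^*=\inf\{\beta\in(0,1):\rho_\beta(\sum_{i=1}^nX_i)\le\sum_{i=1}^n\rho_\alpha(X_i)\}$, with the convention $\inf\emptyset=1$. *)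

(* Defs.v *)
From HB Require Import structures.
From mathcomp Require Import all_boot all_order all_algebra.
From mathcomp Require Import all_classical all_reals all_analysis.
Set Implicit Arguments. Unset Strict Implicit. Unset Printing Implicit Defensive.
Import Order.TTheory GRing.Theory Num.Theory.
Local Open Scope classical_set_scope.
Local Open Scope ring_scope.

Section Risk.
Context {d : measure_display} {T : measurableType d} {R : realType}.
Variable P : probability T R.

Definition atomless : Prop :=
  forall A : set T, measurable A -> (0 < P A)%E ->
    exists B : set T, [/\ measurable B, B `<=` A, (0 < P B)%E & (P B < P A)%E].

(* VaR_a(X) = inf {x : P(X <= x) >= 1 - a}, used for a in (0,1) (then finite) *)
Definition VaR (a : R) (X : T -> R) : R :=
  inf [set x : R | ((1 - a)%:E <= P [set w | (X w <= x)%R])%E].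

Definition ES (a : R) (X : T -> R) : \bar R :=
  ((a^-1)%:E * \int[lebesgue_measure]_(b in `]0%R, a[%classic) (VaR b X)%:E)%E.

(* alpha* with convention inf set0 = 1 *)
Definition alpha_star {n : nat} (rho : R -> (T -> R) -> \bar R) (a : R)
    (X : 'I_n -> T -> R) : R :=
  let S := [set b : R | (0 < b < 1)%R /\
     (rho b (fun w => (\sum_(i < n) X i w)%R) <= \sum_(i < n) rho a (X i))%E] in
  if pselect (S !=set0) then inf S else 1.

Definition DQ {n : nat} (rho : R -> (T -> R) -> \bar R) (a : R)
    (X : 'I_n -> T -> R) : R := alpha_star rho a X / a.

Definition DQ_VaR {n : nat} (a : R) (X : 'I_n -> T -> R) : R :=
  DQ (fun b Y => (VaR b Y)%:E) a X.
Definition DQ_ES {n : nat} (a : R) (X : 'I_n -> T -> R) : R :=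
  DQ ES a X.

Definition L0n (n : nat) : set ('I_n -> T -> R) :=
  [set X | forall i, measurable_fun setT (X i)].
Definition L1n (n : nat) : set ('I_n -> T -> R) :=
  [set X | forall i, measurable_fun setT (X i) /\
                     P.-integrable setT (EFin \o X i)].
End Risk.
Arguments atomless {d T R} P.
Arguments VaR {d T R} P a X.
Arguments ES {d T R} P a X.
Arguments DQ_VaR {d T R} P {n} a X.
Arguments DQ_ES {d T R} P {n} a X.
Arguments L0n {d T R} n.
Arguments L1n {d T R} P n.

(* Main.v *)
(* VaR.  By right continuity P(X_i > VaR_a(X_i)) <= a, so a union bound gives
   VaR_{na}(sum X_i) <= sum VaR_a(X_i) and DQ <= n.  Conversely, for indicators
   of disjoint events of probability c <= a every VaR_a(X_i) is 0, while
   VaR_b(sum X_i) <= 0 exactly when b >= nc.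
   ES.  Subadditivity, obtained from the Rockafellar-Uryasev formula
   a ES_a(X) = min_c (a c + E(X - c)^+), gives DQ <= 1.  Conversely, take
   X_1 = 1_A and X_2 = - 1_{A \ D} with D inside A, P(D) = t P(A) and P(A)
   small: then sum ES_a(X_i) = P(A)/a, while ES_b(X_1 + X_2) is
   min(1, t P(A)/b). *)
Require Import Defs.
From mathcomp Require Import all_boot all_order all_algebra.
From mathcomp Require Import all_classical all_reals all_analysis.
From mathcomp Require Import measurable_realfun lra.
Import Order.TTheory GRing.Theory Num.Theory.
Local Open Scope classical_set_scope.
Local Open Scope ring_scope.
Import numFieldNormedType.Exports.

(** * Value-at-Risk and tail probabilities *)

Section var.
Context {d : measure_display} {T : measurableType d} {R : realType}.
Variable P : probability T R.
Implicit Types (Y : T -> R) (b x : R).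

Lemma measurable_gt_set {Y} x : measurable_fun setT Y ->
  measurable [set w | x < Y w].
Proof.
move=> mY; rewrite [X in measurable X](_ : _ = setT `&` Y @^-1` `]x, +oo[).
  exact: mY.
by apply/seteqP; split=> w /=; rewrite in_itv/= andbT //; case.
Qed.

Lemma measurable_le_set {Y} x : measurable_fun setT Y ->
  measurable [set w | Y w <= x].
Proof.
move=> mY; rewrite [X in measurable X](_ : _ = setT `&` Y @^-1` `]-oo, x]).
  exact: mY.
by apply/seteqP; split=> w /=; rewrite in_itv/= //; case.
Qed.

(** Right continuity of the cdf makes the infimum in [VaR] attained, so quantile comparisons become
    tail bounds. The limits of the cdf at both infinities, with [b] in (0,1), make the set nonempty
    and bounded below, so [inf] takes no default value. *)
Lemma VaR_le {Y b} x : measurable_fun setT Y -> 0 < b < 1 ->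
  (VaR P b Y <= x) = (P [set w | (x < Y w)%R] <= b%:E)%E.
Proof.
move=> mY /andP[b0 b1].
pose Z : {RV P >-> R} := mfun_Sub (mem_set mY).
have FE y : P [set w | (Y w <= y)%R] = cdf Z y.
  by rewrite /cdf /distribution /pushforward; congr (P _);
    apply/seteqP; split => w /=; rewrite in_itv.
have -> : (P [set w | (x < Y w)%R] <= b%:E)%E = ((1 - b)%:E <= cdf Z x)%E.
  have -> : [set w | x < Y w] = ~` [set w | Y w <= x].
    by apply/seteqP; split=> w /=; rewrite ltNge => /negP.
  rewrite probability_setC; last exact: measurable_le_set.
  by rewrite FE EFinB leeBlDr ?leeBlDl ?fin_num_measure// addeC.
rewrite /VaR; under eq_set => y do rewrite FE.
have [y0 y0S] : exists y, ((1 - b)%:E <= cdf Z y)%E.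
  apply: contrapT => /forallNP h.
  suff : (1%:E <= (1 - b)%:E)%E by rewrite lee_fin leNgt ltrBlDr ltrDl b0.
  apply: (cvge_le _ (cvg_cdfy1 Z)); apply: nearW => y.
  by rewrite leNgt; apply/negP => /ltW; exact: h.
have [z zS] : exists z, (cdf Z z < (1 - b)%:E)%E.
  apply: contrapT => /forallNP h.
  suff : ((1 - b)%:E <= 0%:E)%E by rewrite lee_fin leNgt subr_gt0 b1.
  apply: (cvge_ge _ (cvg_cdfNy0 Z)); apply: nearW => y.
  by rewrite leNgt; apply/negP; exact: h.
have lbz : lbound [set y | ((1 - b)%:E <= cdf Z y)%E] z.
  move=> y /= yS; rewrite leNgt; apply/negP => yz.
  have := lt_le_trans zS (le_trans yS (cdf_nondecreasing _ (ltW yz))).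
  by rewrite ltxx.
apply/idP/idP => [infx|xS]; last by apply: ge_inf => //; exists z.
apply: cvge_ge (@cdf_right_continuous _ _ _ _ Z x).
near=> y.
have xy : x < y by near: y; exact: nbhs_right_gt.
have [u /= uS uy] : exists2 u, ((1 - b)%:E <= cdf Z u)%E & u < y.
  by apply: inf_lt => //; [exists y0|exact: le_lt_trans infx xy].
by rewrite (le_trans uS)// cdf_nondecreasing// ltW.
Unshelve. all: by end_near. Qed.

End var.

(** * Atomless probability spaces *)

Section atomless.
Context {d : measure_display} {T : measurableType d} {R : realType}.
Variable P : probability T R.
Hypothesis atP : atomless P.

Lemma probability_fineK {A : set T} : measurable A -> P A = (fine (P A))%:E.
Proof. by move=> mA; rewrite fineK// fin_num_measure. Qed.

Lemma fine_probabilityD {A B : set T} : measurable A -> measurable B ->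
  B `<=` A -> fine (P (A `\` B)) = fine (P A) - fine (P B).
Proof.
move=> mA mB BA; rewrite measureD ?setIidr//; last first.
  by rewrite -ge0_fin_numE// fin_num_measure.
by rewrite fineB// fin_num_measure.
Qed.

(** Repeated halving: given a subset of [C] of intermediate mass, either it or its complement in [C]
    has at most half the mass of [C]. *)
Lemma atomless_small {A : set T} {e : R} : measurable A -> 0 < fine (P A) ->
  0 < e -> exists B, [/\ measurable B, B `<=` A & 0 < fine (P B) < e].
Proof.
move=> mA A0 e0.
have half n : exists B, [/\ measurable B, B `<=` A, 0 < fine (P B) &
    fine (P B) * 2 ^+ n <= fine (P A)].
  elim: n => [|n [C [mC CA C0 Cn]]].
    by exists A; split => //; rewrite mulr1.
  have [|B [mB BC B0 BltC]] := atP C mC.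
    by rewrite (probability_fineK mC) lte_fin.
  have CB := fine_probabilityD mC mB BC.
  have mD : measurable (C `\` B) by exact: measurableD.
  move: B0 BltC; rewrite (probability_fineK mC) (probability_fineK mB) !lte_fin.
  move=> B0 BltC.
  have n0 : 0 < 2 ^+ n :> R by rewrite exprn_gt0.
  have [BC2|CB2] := leP (2 * fine (P B)) (fine (P C)).
    exists B; split => //; first exact: subset_trans CA.
    by apply: le_trans Cn; rewrite exprS mulrA ler_pM2r// mulrC.
  exists (C `\` B); split => //.
  - by apply: subset_trans CA; exact: subDsetl.
  - by rewrite CB subr_gt0.
  - apply: le_trans Cn; rewrite exprS mulrA ler_pM2r// CB; lra.
have [B [mB BA B0 Bn]] := half (Num.bound (fine (P A) / e)).
exists B; split => //; rewrite B0/=.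
have := @upper_nthrootP _ (fine (P A) / e) _ (leqnn _).
rewrite ltr_pdivrMr// mulrC => /(le_lt_trans Bn).
by rewrite ltr_pM2r// exprn_gt0.
Qed.

(* Greedy choice: every step realises at least half of the possible gain, so
   that the union of the chosen sets admits no further gain. *)
Lemma measurable_maximal {F : set T -> Prop} {A0 : set T} :
  (forall A, F A -> measurable A) -> F A0 ->
  (forall A : (set T)^nat, (forall n, F (A n)) ->
     {homo A : n m / (n <= m)%N >-> (n <= m)%O} -> F (\bigcup_n A n)) ->
  exists2 B, F B & A0 `<=` B /\
    forall C, F C -> B `<=` C -> fine (P C) <= fine (P B).
Proof.
move=> mF FA0 Fcup.
pose step (X Y : {B | F B}) := sval X `<=` sval Y /\
  forall C, F C -> sval X `<=` C ->
    fine (P C) - fine (P (sval X)) <=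
    2 * (fine (P (sval Y)) - fine (P (sval X))).
have next X : {Y | step X Y}.
  apply: cid; case: X => X FX.
  have XX : F X /\ X `<=` X by split.
  pose G := [set fine (P C) | C in [set C | F C /\ X `<=` C]].
  have supG : has_sup G.
    split; first by exists (fine (P X)) => /=; exists X.
    exists 1 => _ [C [FC _] <-]; have mC := mF _ FC.
    by rewrite -lee_fin -probability_fineK// probability_le1.
  have XG : fine (P X) <= sup G.
    by apply: ub_le_sup; [exact: (proj2 supG)|exists X].
  have [XltG|GleX] := ltP (fine (P X)) (sup G); last first.
    exists (exist _ X FX); split => //= C FC XC; rewrite subrr mulr0 subr_le0.
    by apply: le_trans GleX; apply: ub_le_sup; [exact: (proj2 supG)|exists C].
  have [|_ [Y [FY XY] <-] Ylt] :=
    sup_adherent (E := G) (eps := (sup G - fine (P X)) / 2) _ supG.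
    by rewrite divr_gt0// subr_gt0.
  exists (exist _ Y FY); split => //= C FC XC.
  have CG : fine (P C) <= sup G.
    by apply: ub_le_sup; [exact: (proj2 supG)|exists C].
  lra.
have [f [f0 fS]] := dependent_choice next (exist _ A0 FA0).
pose A n := sval (f n).
have FA n : F (A n) by exact: svalP.
have Amono : {homo A : n m / (n <= m)%N >-> (n <= m)%O}.
  by apply/nondecreasing_seqP => n; rewrite subsetEset; case: (fS n).
have FB := Fcup A FA Amono.
exists (\bigcup_n A n) => //; split.
  by move=> x A0x; exists 0%N => //; rewrite /A f0.
move=> C FC BC.
have /fine_cvgP[_ Alim] :
    (P \o A) x @[x --> \oo] --> (fine (P (\bigcup_n A n)))%:E.
  rewrite -probability_fineK; last exact: mF.
  apply: nondecreasing_cvg_mu => //; [by move=> n; apply: mF|exact: mF].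
have Alim2 : fine (P (A n.+1)) @[n --> \oo] --> fine (P (\bigcup_n A n)).
  by rewrite (cvg_shiftS (fun n => fine (P (A n)))).
(* The gain bound at stage n reads P(C) <= 2 P(A_{n+1}) - P(A_n), and its right side tends to the
   mass of the union. *)
have lim : 2 * fine (P (A n.+1)) - fine (P (A n)) @[n --> \oo] -->
    2 * fine (P (\bigcup_n A n)) - fine (P (\bigcup_n A n)).
  by apply: cvgB => //; apply: cvgMr.
have -> : fine (P (\bigcup_n A n)) =
    2 * fine (P (\bigcup_n A n)) - fine (P (\bigcup_n A n)) by lra.
apply: (cvgr_to_ge lim); apply: nearW => n.
have AC : A n `<=` C by apply: subset_trans BC; exact: bigcup_sup.
have [_ /(_ C FC AC)] := fS n; rewrite -/(A n) -/(A n.+1); lra.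
Qed.

(** Sierpinski's intermediate value theorem. Among the sets between [A] and [B] of mass at most [s],
    a maximal one has mass [s]: otherwise a small enough piece of the rest of [B] could be added. *)
Lemma atomless_between {A B : set T} {s : R} :
  measurable A -> measurable B -> A `<=` B -> fine (P A) <= s <= fine (P B) ->
  exists C, [/\ measurable C, A `<=` C, C `<=` B & fine (P C) = s].
Proof.
move=> mA mB AB /andP[As sB].
pose F C := [/\ measurable C, A `<=` C, C `<=` B & fine (P C) <= s].
have [||D FD Dmono|C [mC AC CB Cs] [_ Cmax]] := @measurable_maximal F A.
- by move=> D [].
- by split => //; apply: subset_refl.
- have mD : measurable (\bigcup_n D n).
    by apply: bigcup_measurable => n _; case: (FD n).
  split => //.
  + by move=> x Ax; exists 0%N => //; case: (FD 0%N) => _ /(_ x Ax).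
  + by move=> x [n _ Dx]; case: (FD n) => _ _ /(_ x Dx).
  + have /fine_cvgP[_ Dlim] :
        (P \o D) x @[x --> \oo] --> (fine (P (\bigcup_n D n)))%:E.
      rewrite -probability_fineK//; apply: nondecreasing_cvg_mu => // n.
      by case: (FD n).
    by apply: (cvgr_to_le Dlim); apply: nearW => n; case: (FD n).
exists C; split => //; apply/eqP; rewrite eq_le Cs leNgt; apply/negP => Clts.
have mBC : measurable (B `\` C) by exact: measurableD.
have PBC := fine_probabilityD mB mC CB.
have [||E [mE EBC /andP[E0 Es]]] := atomless_small (e := s - fine (P C)) mBC.
- by rewrite PBC subr_gt0 (lt_le_trans Clts).
- by rewrite subr_gt0.
have CE : fine (P (C `|` E)) = fine (P C) + fine (P E).
  rewrite measureU ?fineD ?fin_num_measure//.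
  by apply/seteqP; split => // x [Cx /EBC[]].
have := Cmax (C `|` E); rewrite CE -subr_le0 addrAC subrr add0r leNgt E0.
suff FCE : F (C `|` E) by move=> /(_ FCE (@subsetUl _ _ _)).
split.
- exact: measurableU.
- by move=> x /AC; left.
- by move=> x [/CB//|/EBC[]].
- by rewrite CE -lerBrDl ltW.
Qed.

(** The increments of this chain serve as disjoint events of probability [c]. Capping the mass at 1
    makes the step possible at every stage, even once the space is exhausted. *)
Lemma atomless_chain {c : R} : 0 <= c ->
  {U : (set T)^nat | [/\ U 0%N = set0, forall i, measurable (U i),
    forall i, U i `<=` U i.+1 &
    forall i, i%:R * c <= 1 -> fine (P (U i)) = i%:R * c]}.
Proof.
move=> c0.
pose step (X Y : {B : set T | measurable B}) := sval X `<=` sval Y /\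
  fine (P (sval Y)) = Num.min 1 (fine (P (sval X)) + c).
have next X : {Y | step X Y}.
  apply: cid; case: X => X mX.
  have X1 : fine (P X) <= 1.
    by rewrite -lee_fin -probability_fineK ?probability_le1.
  have [|Y [mY XY _ PY]] := @atomless_between X setT
      (Num.min 1 (fine (P X) + c)) mX measurableT (@subsetT _ _).
    by rewrite probability_setT/= ge_min lexx le_min X1 lerDl c0.
  by exists (exist _ Y mY).
have [U [U0 US]] := dependent_choice next (exist _ set0 measurable0).
exists (fun i => sval (U i)); split.
- by rewrite U0.
- by move=> i; exact: svalP.
- by move=> i; case: (US i).
elim => [|i IH] ic; first by rewrite U0 /= measure0 mul0r.
have iE : i.+1%:R * c = i%:R * c + c by rewrite -natr1 mulrDl mul1r.
have [_ ->] := US i; rewrite IH -?iE; last first.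
  by rewrite (le_trans _ ic)// iE lerDl.
by apply/min_idPr.
Qed.

End atomless.

(** * The range for Value-at-Risk *)

Section alpha_star.
Context {d : measure_display} {T : measurableType d} {R : realType} {n : nat}.
Variables (rho : R -> (T -> R) -> \bar R) (a : R) (X : 'I_n -> T -> R).

Let accept b :=
  (rho b (fun w => (\sum_(i < n) X i w)%R) <= \sum_(i < n) rho a (X i))%E.

Let lbound_accept : lbound [set b | (0 < b < 1)%R /\ accept b] 0.
Proof. by move=> b [/andP[/ltW]]. Qed.

Lemma alpha_star_le c : 0 < c < 1 -> accept c -> alpha_star rho a X <= c.
Proof.
move=> c01 cX; rewrite /alpha_star; case: pselect => [S0|[]]; last by exists c.
by apply: ge_inf => //; exists 0.
Qed.

Lemma alpha_star_ge0_le1 : 0 <= alpha_star rho a X <= 1.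
Proof.
rewrite /alpha_star; case: pselect => [S0|S0]; last by rewrite ler01 lexx.
rewrite lb_le_inf//=; have [c [c01 cX]] := S0.
rewrite (@le_trans _ _ c)//; last by case/andP: c01 => _ /ltW.
by apply: ge_inf => //; exists 0.
Qed.

(** Both endpoints are covered: for t = 0 the infimum is approached but not attained, and for t = 1
    no level is accepted and the convention yields 1. *)
Lemma alpha_star_eq t : 0 <= t <= 1 ->
  (forall b, 0 < b < 1 -> accept b = (t <= b)) -> alpha_star rho a X = t.
Proof.
move=> /andP[t0 t1] tX; apply/eqP; rewrite eq_le; apply/andP; split.
  apply/ler_addgt0Pr => e e0.
  have [te1|te1] := ltP (t + e) 1.
    have te01 : 0 < t + e < 1 by rewrite te1 ltr_wpDl.
    by apply: alpha_star_le => //; rewrite tX// lerDl ltW.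
  by rewrite (le_trans _ te1)//; case/andP: alpha_star_ge0_le1.
rewrite /alpha_star; case: pselect => [S0|S0]; last by [].
by apply: lb_le_inf => // b [b01]; rewrite -/(accept b) tX.
Qed.

End alpha_star.

(** * Quantiles of indicators and of sums *)

Section var_range.
Context {d : measure_display} {T : measurableType d} {R : realType}.
Variable P : probability T R.

(** The tail P(1_D > v) equals 1 for v < 0, P(D) for 0 <= v < 1, and 0 from 1 on. *)
Lemma VaR_indic {D : set T} {b : R} : measurable D -> 0 < b < 1 ->
  VaR P b \1_D = (b < fine (P D))%R%:R.
Proof.
move=> mD b01; have [b0 b1] := andP b01.
have mI : measurable_fun setT (\1_D : T -> R) by exact: measurable_indic.
have vle v := VaR_le P v mI b01.
(* The tail criterion at the quantile itself: P(1_D > v) <= b, which excludes values of [v] that are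
   too small. *)
have := vle (VaR P b \1_D); rewrite lexx.
set v := VaR P b \1_D => /esym vP.
apply/eqP; rewrite eq_le; apply/andP; split; last first.
  rewrite leNgt; apply/negP; move: vP => /[swap].
  have [bD|Db] := ltP b (fine (P D)) => vlt; apply/negP; rewrite -ltNge.
    apply: (@lt_le_trans _ _ (P D)).
      by rewrite (probability_fineK P mD) lte_fin.
    apply: le_measure; rewrite ?inE//; first exact: measurable_gt_set.
    by move=> w Dw /=; rewrite indicE mem_set.
  rewrite [X in P X](_ : _ = setT); first by rewrite probability_setT lte_fin.
  by apply/seteqP; split => // w _ /=; rewrite (lt_le_trans vlt).
rewrite vle; have [bD|Db] := ltP b (fine (P D)).
  rewrite [X in P X](_ : _ = set0) ?measure0 ?lee_fin ?ltW//.
  apply/seteqP; split => // w /=; rewrite indicE.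
  by case: (w \in D); rewrite ?ltxx// ltr10.
rewrite [X in P X](_ : _ = D); first by rewrite probability_fineK.
apply/seteqP; split => w /=; rewrite indicE.
  by have [/set_mem|_] := boolP (w \in D); rewrite // ltxx.
by move/mem_set => ->; exact: ltr01.
Qed.

(** Where the sum exceeds the sum of the quantiles, some X_i exceeds its own quantile, and each such
    event has mass at most [a]. *)
Lemma VaR_sum_le {n : nat} {a : R} {X : 'I_n -> T -> R} :
  (forall i, measurable_fun setT (X i)) -> 0 < a < 1 -> 0 < n%:R * a < 1 ->
  VaR P (n%:R * a) (fun w => \sum_(i < n) X i w) <= \sum_(i < n) VaR P a (X i).
Proof.
move=> mX a01 na01.
have mS : measurable_fun setT (fun w => \sum_(i < n) X i w).
  by apply: measurable_sum.
rewrite VaR_le//.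
pose E i := [set w | VaR P a (X i) < X i w].
have mE i : measurable (E i) by exact: measurable_gt_set.
have PE i : (P (E i) <= a%:E)%E by rewrite -VaR_le.
apply: (@le_trans _ _ (\sum_(i < n) P (E i))%E).
  (* [content_subadditive] takes a family indexed by all naturals, hence the extension by the empty
     set. *)
  pose F k := if insub k is Some i then E i else set0.
  have FE (i : 'I_n) : F i = E i by rewrite /F valK.
  have -> : (\sum_(i < n) P (E i) = \sum_(i < n) P (F i))%E.
    by apply: eq_bigr => i _; rewrite FE.
  apply: (@content_subadditive _ _ _ P _ F) => [k kn| |w /= ltw].
  - by rewrite /F; case: insubP => // i _ _.
  - exact: measurable_gt_set.
  rewrite -bigcup_mkord; apply: contrapT => nF; move: ltw; apply/negP.
  rewrite -leNgt; apply: ler_sum => i _; rewrite leNgt; apply/negP => ltXi.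
  by apply: nF; exists i => //=; rewrite FE.
apply: (@le_trans _ _ (\sum_(i < n) a%:E)%E); first exact: lee_sum.
by rewrite sumEFin sumr_const card_ord mulr_natl.
Qed.

Lemma indic_increment {A B : set T} w : A `<=` B ->
  \1_(B `\` A) w = \1_B w - \1_A w :> R.
Proof.
move=> AB; rewrite setDE indicI indicC !indicE /=.
have [Aw|_] := boolP (w \in A); last by rewrite mulr1 subr0.
have -> : w \in B by apply/mem_set/AB/set_mem.
by rewrite mulr0 subrr.
Qed.

Lemma DQ_VaR_range {n : nat} {a : R} : atomless P -> (0 < n)%N -> 0 < a < 1 ->
  [set DQ_VaR P a X | X in L0n n] =
    [set x : R | 0 <= x <= Num.min (n%:R) a^-1].
Proof.
move=> atP n0 a01; have [a0 a1] := andP a01.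
have nR0 : 0 < n%:R :> R by rewrite ltr0n.
apply/seteqP; split => [_ [X mX <-]|x /=]; rewrite /= /DQ_VaR /DQ.
  set al := alpha_star _ _ _; have /andP[al0 al1] : 0 <= al <= 1.
    exact: alpha_star_ge0_le1.
  rewrite (divr_ge0 al0 (ltW a0))/= le_min; apply/andP; split; last first.
    by rewrite ler_pdivrMr// mulVf// gt_eqF.
  (* For n a >= 1 the level n a lies outside (0,1), but then alpha* <= 1 suffices. *)
  rewrite ler_pdivrMr//; have [na1|na1] := ltP (n%:R * a) 1; last first.
    exact: le_trans na1.
  have na01 : 0 < n%:R * a < 1 by rewrite na1 mulr_gt0.
  apply: alpha_star_le => //; rewrite sumEFin lee_fin.
  exact: VaR_sum_le.
rewrite le_min => /andP[x0 /andP[xn xa]].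
(* The target alpha* is x a = n c. The bound x <= n gives c <= a, and x <= 1/a gives n c <= 1, so
   that n steps of the chain fit. *)
pose c := x * a / n%:R.
have c0 : 0 <= c by rewrite divr_ge0 ?mulr_ge0 ?(ltW a0) ?(ltW nR0).
have nc : n%:R * c = x * a by rewrite /c mulrC divfK// gt_eqF.
have xa1 : x * a <= 1 by rewrite -ler_pdivlMr// div1r.
have ca : c <= a by rewrite ler_pdivrMr// mulrC ler_pM2l.
have [U [U0 mU Umono PU]] := atomless_chain P atP c0.
pose X (i : 'I_n) : T -> R := \1_(U i.+1 `\` U i).
have sumX : (fun w => \sum_(i < n) X i w) = \1_(U n).
  apply/funext => w.
  under eq_bigr => i _ do rewrite /X indic_increment//.
  rewrite -(big_mkord xpredT (fun i => \1_(U i.+1) w - \1_(U i) w)).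
  by rewrite telescope_sumr// U0 indic0 subr0.
have VX i : VaR P a (X i) = 0.
  have mD : measurable (U i.+1 `\` U i) by exact: measurableD.
  rewrite VaR_indic// fine_probabilityD//.
  have in1 : i.+1%:R * c <= 1.
    by apply: le_trans xa1; rewrite -nc ler_wpM2r// ler_nat.
  rewrite !PU//; last by apply: le_trans in1; rewrite ler_wpM2r// ler_nat.
  by rewrite -mulrBl -natrB// subSnn mul1r ltNge ca.
exists X; first by move=> i; apply: measurable_indic; exact: measurableD.
rewrite (@alpha_star_eq _ _ _ _ _ _ _ (x * a)) ?mulfK ?gt_eqF//.
  by rewrite xa1 mulr_ge0// ltW.
(* The right side is 0, so [b] is accepted exactly when P(U n) = x a <= b. *)
move=> b b01; rewrite sumEFin lee_fin sumX VaR_indic//.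
rewrite big1// PU nc//.
by case: ltP; rewrite ?lexx// ler10.
Qed.

End var_range.

(** * Subadditivity of Expected Shortfall *)

Section es_subadditive.
Context {d : measure_display} {T : measurableType d} {R : realType}.
Variable P : probability T R.
Implicit Types (X : T -> R) (a b c : R).

Let mu : {measure set _ -> \bar R} := @lebesgue_measure R.

Lemma lebesgue_measure_itv0 {p : R} : 0 <= p ->
  lebesgue_measure (`]0, p[%classic : set R) = p%:E.
Proof.
rewrite lebesgue_measure_itv/= lte_fin le_eqVlt => /predU1P[<-|->].
  by rewrite ltxx.
by rewrite sube0.
Qed.

Lemma VaR_nonincreasing {X b b'} : measurable_fun setT X ->
  0 < b < 1 -> 0 < b' < 1 -> b <= b' -> VaR P b' X <= VaR P b X.
Proof.
move=> mX b01 b'01 bb'; rewrite VaR_le//.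
by rewrite (@le_trans _ _ b%:E) ?lee_fin// -VaR_le.
Qed.

Lemma VaR_gtE {X b} c : measurable_fun setT X -> 0 < b < 1 ->
  (c < VaR P b X) = (b < fine (P [set w | (c < X w)%R])).
Proof.
move=> mX b01; rewrite ltNge VaR_le// -ltNge -lte_fin fineK//.
by rewrite fin_num_measure//; exact: measurable_gt_set.
Qed.

(** The preimage of an upper ray is an initial interval of levels, by [VaR_gtE]. *)
Lemma measurable_VaR {X} : measurable_fun setT X ->
  measurable_fun (`]0, 1[%classic : set R) (fun b => VaR P b X).
Proof.
move=> mX; apply: (measurability (@RGenOInfty.G R)) => [|/= _ [_] [r] -> <-].
  exact: RGenOInfty.measurableE.
rewrite [X in measurable X](_ : _ =
    `]0, 1[ `&` `]-oo, fine (P [set w | (r < X w)%R])[).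
  exact: measurableI.
apply/seteqP; split => b /=; rewrite !in_itv/= andbT => -[b01 rX]; split => //.
  by rewrite -VaR_gtE.
by rewrite VaR_gtE.
Qed.

Lemma measurable_excess {d'} {T' : measurableType d'} {D : set T'}
    {f : T' -> R} c :
  measurable_fun D f -> measurable_fun D (fun x => Num.max (f x - c) 0).
Proof. by move=> mf; apply: measurable_maxr => //; exact: measurable_funB. Qed.

(* Under the uniform law on (0,1), b |-> VaR_b X has the law of X; it suffices
   to compare the two tails. *)
Lemma expectation_excess {X} c : measurable_fun setT X ->
  (\int[P]_w (Num.max (X w - c) 0)%:E =
   \int[mu]_(b in `]0%R, 1%R[) (Num.max (VaR P b X - c) 0)%:E)%E.
Proof.
move=> mX.
(* Extension by zero gives a total random variable for the uniform law and avoids levels outside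
   (0,1). *)
pose g := (fun b => Num.max (VaR P b X - c) 0) \_ `]0, 1[.
have mg : measurable_fun (setT : set (measurableTypeR R)) g.
  apply/(measurable_restrictT _ _).1 => //.
  by apply: measurable_excess; exact: measurable_VaR.
have g0 b : 0 <= g b.
  by rewrite /g patchE; case: ifP; rewrite // le_max lexx orbT.
pose U : probability (measurableTypeR R) R := uniform_prob (@ltr01 R).
pose Y : {RV P >-> R} := mfun_Sub (mem_set (measurable_excess c mX)).
pose Z : {RV U >-> R} :=
    @mfun_Sub _ _ (measurableTypeR R) R g (mem_set mg).
transitivity ('E_P[Y])%E; first by rewrite expectation_def.
transitivity ('E_U[Z])%E; last first.
  rewrite expectation_def integral_uniform//=; last exact/measurable_EFinP.
  rewrite subr0 invr1 mul1e.
  rewrite -[in RHS](@setIidr _ `[0, 1] `]0, 1[); last exact: subset_itvW.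
  rewrite integral_mkcondr; apply: eq_integral => b _.
  by rewrite /g !patchE; case: ifP.
(* Layer-cake formula: both expectations become integrals of tails over r >= 0. *)
rewrite ge0_expectation_ccdf; last by move=> w; rewrite /= le_max lexx orbT.
rewrite ge0_expectation_ccdf//; apply: eq_integral => r.
rewrite inE/= in_itv/= andbT => r0.
pose p := fine (P [set w | (c + r < X w)%R]).
have mp := measurable_gt_set (c + r) mX.
have p0 : 0 <= p by exact: fine_ge0.
have p1 : p <= 1 by rewrite -lee_fin -probability_fineK// probability_le1.
have excess_gt y : (r < Num.max (y - c) 0) = (c + r < y).
  by rewrite lt_max [r < 0]ltNge r0 orbF ltrBrDl.
rewrite /ccdf /distribution /pushforward/=.
transitivity p%:E.
  rewrite -probability_fineK//; congr (P _).
  by apply/seteqP; split => w /=; rewrite in_itv/= andbT excess_gt.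
(* For a level [b], VaR_b(X) > c + r exactly when b < p, so the uniform tail is the length [p] of
   this interval. *)
rewrite [X in _ = uniform_prob _ X](_ : _ = `]0, p[%classic).
  rewrite /uniform_prob (eq_integral (cst 1%E)); last first.
    move=> x; rewrite inE/= in_itv/= => /andP[x0 xp].
    by rewrite /uniform_pdf (ltW x0) (le_trans (ltW xp) p1) subr0 invr1.
  by rewrite integral_cst// mul1e; exact/esym/lebesgue_measure_itv0.
apply/seteqP; split => b /=; rewrite !in_itv/= andbT /g patchE.
  case: ifPn => [|_]; last by rewrite ltNge r0.
  rewrite inE/= in_itv/= => b01; rewrite excess_gt VaR_gtE// -/p => ->.
  by case/andP: b01 => ->.
move=> /andP[b0 bp]; have b01 : 0 < b < 1 by rewrite b0 (lt_le_trans bp).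
rewrite mem_set; last by rewrite /= in_itv.
by rewrite excess_gt VaR_gtE.
Qed.

(** * The Rockafellar-Uryasev formula *)

Section rockafellar_uryasev.
Context {X : T -> R} {a : R}.
Hypotheses (mX : measurable_fun setT X)
  (iX : P.-integrable setT (EFin \o X)) (a01 : 0 < a < 1).

Let excess c b := (Num.max (VaR P b X - c) 0)%:E.

Let subitv : (`]0, a[%classic : set R) `<=` `]0, 1[%classic.
Proof.
move=> b /=; rewrite !in_itv/=; case/andP: a01 => a0 a1.
by move=> /andP[-> /lt_trans->].
Qed.

(** Transferred to [P] by [expectation_excess], where |X - c| dominates the excess. *)
Let integrable_excess c : mu.-integrable `]0, 1[%classic (excess c).
Proof.
apply/integrableP; split.
  by apply/measurable_EFinP; apply: measurable_excess; exact: measurable_VaR.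
under eq_integral => b _ do
  rewrite gee0_abs ?lee_fin ?le_max ?lexx ?orbT// /excess.
rewrite -expectation_excess//.
apply: integrable_lty => //.
apply: (le_integrable _ _ _
  (_ : P.-integrable setT (EFin \o (X \- cst c)))) => //.
- by apply/measurable_EFinP; exact: measurable_excess.
- move=> w _ /=; rewrite lee_fin ger0_norm ?le_max ?lexx ?orbT//.
  by rewrite ge_max ler_norm normr_ge0.
- under [X in _.-integrable _ X]eq_fun => w do rewrite /= EFinB.
  apply: integrableB => //; exact: finite_measure_integrable_cst.
Qed.

Let integrable_excessS c : mu.-integrable `]0, a[%classic (excess c).
Proof. exact: integrableS (integrable_excess c). Qed.

Let integrable_cst_itv c : mu.-integrable `]0, a[%classic (cst c%:E).
Proof.
apply/integrableP; split => //.
rewrite (eq_integral (cst `|c|%:E))// integral_cst//= lebesgue_measure_itv/=.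
by case: ifP => _; rewrite ?mule0 ?ltry// -EFinB -EFinM ltry.
Qed.

Let integral_cst_excess c :
  (\int[mu]_(b in `]0%R, a[) (c%:E + excess c b) =
   (a * c)%:E + \int[mu]_(b in `]0%R, a[) excess c b)%E.
Proof.
rewrite integralD//; last exact: integrable_cst_itv.
rewrite integral_cst//= lebesgue_measure_itv0 -?EFinM 1?mulrC//.
by case/andP: a01 => /ltW.
Qed.

(** Below level [a] the quantile is at least VaR_a(X), so it is that constant plus an integrable
    excess. *)
Lemma integrable_VaR : mu.-integrable `]0, a[%classic (fun b => (VaR P b X)%:E).
Proof.
have [a0 a1] := andP a01.
have int_excess : mu.-integrable `]0, a[%classic
    (fun b => (VaR P a X)%:E + excess (VaR P a X) b)%E.
  by apply: integrableD => //; exact: integrable_cst_itv.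
apply: eq_integrable int_excess => //.
move=> b; rewrite inE/= in_itv/= => /andP[b0 ba].
have b01 : 0 < b < 1 by rewrite b0 (lt_trans ba).
rewrite /excess max_l ?subr_ge0 ?VaR_nonincreasing ?(ltW ba)//.
by rewrite -EFinD addrC subrK.
Qed.

(** Integrate v <= c + (v - c)^+ over (0,a), then enlarge the domain of the nonnegative excess to
    (0,1). *)
Lemma integral_VaR_le c : (\int[mu]_(b in `]0%R, a[) (VaR P b X)%:E <=
  (a * c)%:E + \int[P]_w (Num.max (X w - c) 0)%:E)%E.
Proof.
apply: (@le_trans _ _ (\int[mu]_(b in `]0%R, a[) (c%:E + excess c b))%E).
  apply: le_integral => //; first exact: integrable_VaR.
    by apply: integrableD => //; exact: integrable_cst_itv.
  by move=> b _; rewrite /excess -EFinD lee_fin -lerBlDl le_max lexx.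
rewrite integral_cst_excess leeD2l// expectation_excess//.
apply: ge0_subset_integral => //.
  by apply/measurable_EFinP; apply: measurable_excess; exact: measurable_VaR.
by move=> b _; rewrite lee_fin le_max lexx orbT.
Qed.

(** At this [c] nothing is lost: the excess is VaR_b(X) - c below level [a] and vanishes from [a]
    on. *)
Lemma integral_VaR_eq : let c := VaR P a X in
 (\int[mu]_(b in `]0%R, a[) (VaR P b X)%:E =
  (a * c)%:E + \int[P]_w (Num.max (X w - c) 0)%:E)%E.
Proof.
move=> c; have [a0 a1] := andP a01.
rewrite expectation_excess// (_ : \int[mu]_(b in `]0%R, 1%R[) _ =
    \int[mu]_(b in `]0%R, a[) excess c b)%E.
  rewrite -integral_cst_excess; apply: eq_integral => b.
  rewrite inE/= in_itv/= => /andP[b0 ba].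
  have b01 : 0 < b < 1 by rewrite b0 (lt_trans ba).
  rewrite /excess max_l ?subr_ge0 ?VaR_nonincreasing ?(ltW ba)//.
  by rewrite -EFinD addrC subrK.
rewrite integral_mkcond [RHS]integral_mkcond; apply: eq_integral => b _.
rewrite !patchE; have [ba|ab] := ltP b a.
  suff -> : (b \in `]0%R, 1%R[%classic) = (b \in `]0%R, a[%classic) by [].
  apply/idP/idP; rewrite !inE/= !in_itv/= => /andP[-> _] //.
  by rewrite (lt_trans ba).
rewrite [b \in `]0, a[%classic]memNset; last first.
  by rewrite /= in_itv/= [b < a]ltNge ab andbF.
case: ifPn => //; rewrite inE/= in_itv/= => b01.
by rewrite max_r// subr_le0 VaR_nonincreasing.
Qed.

End rockafellar_uryasev.

(** The upper bound for the sum is taken at the sum of the individual minimizers; positive parts are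
    subadditive. *)
Lemma ES_sum_le {n : nat} {a : R} {X : 'I_n -> T -> R} :
  L1n P n X -> 0 < a < 1 ->
  (ES P a (fun w => \sum_(i < n) X i w)%R <= \sum_(i < n) ES P a (X i))%E.
Proof.
move=> L1X a01; have [a0 a1] := andP a01.
have mX i := (L1X i).1; have iX i := (L1X i).2.
pose c i := VaR P a (X i).
have mS : measurable_fun setT (fun w => \sum_(i < n) X i w).
  exact: measurable_sum.
have iS : P.-integrable setT (EFin \o (fun w => \sum_(i < n) X i w)).
  under [X in _.-integrable _ X]eq_fun => w do rewrite /= -sumEFin.
  by apply: (@integrable_sum _ _ _ P _ _ _ _ xpredT (fun i => EFin \o X i)).
(* Factoring 1/a out of an extended-real sum requires that no opposite infinities meet; the
   integrals are finite. *)
rewrite /ES -fin_num_sume_distrr//; last first.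
  by move=> i j _ _; rewrite fin_num_adde_defl// integrable_fin_num//;
    exact: integrable_VaR.
apply: lee_wpmul2l; first by rewrite lee_fin invr_ge0 ltW.
apply: (le_trans (integral_VaR_le mS iS a01 (\sum_(i < n) c i))).
under [leRHS]eq_bigr => i _ do rewrite (integral_VaR_eq (mX i) (iX i) a01).
rewrite big_split/= sumEFin mulr_sumr leeD2l//.
rewrite -ge0_integral_sum//; last 2 first.
- by move=> i; by apply/measurable_EFinP; exact: measurable_excess.
- by move=> i w _; rewrite lee_fin le_max lexx orbT.
apply: ge0_le_integral => //.
- by move=> w _; rewrite lee_fin le_max lexx orbT.
- by apply/measurable_EFinP; exact: measurable_excess.
- apply: emeasurable_sum => i.
  by apply/measurable_EFinP; exact: measurable_excess.
move=> w _; rewrite sumEFin lee_fin ge_max; apply/andP; split.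
  by rewrite -sumrB; apply: ler_sum => i _; rewrite le_max lexx.
by apply: sumr_ge0 => i _; rewrite le_max lexx orbT.
Qed.

End es_subadditive.

(** * The range for Expected Shortfall *)

Section es_range.
Context {d : measure_display} {T : measurableType d} {R : realType}.
Variable P : probability T R.

Lemma ES_indic {D : set T} {b : R} : measurable D -> 0 < b < 1 ->
  ES P b \1_D = (Num.min 1 (fine (P D) / b))%:E.
Proof.
move=> mD b01; have [b0 b1] := andP b01.
have q0 : 0 <= fine (P D) by exact: fine_ge0.
rewrite /ES (_ : \int[_]_(c in _) _ = (Num.min b (fine (P D)))%:E)%E.
  rewrite -EFinM minr_pMr ?invr_ge0 ?(ltW b0)// mulVf ?gt_eqF//.
  by rewrite [_^-1 * _]mulrC.
transitivity (\int[lebesgue_measure]_(c in `]0%R, b[)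
    (\1_(`]-oo, fine (P D)[%classic : set R) c)%:E)%E.
  apply: eq_integral => c; rewrite inE/= in_itv/= => /andP[c0 cb].
  have c01 : 0 < c < 1 by rewrite c0 (lt_trans cb).
  rewrite VaR_indic//; congr EFin; rewrite indicE; congr (_%:R).
  by congr nat_of_bool; apply/idP/idP; rewrite inE/= in_itv.
rewrite integral_indic//= -(@lebesgue_measure_itv0 R); last first.
  by rewrite le_min (ltW b0).
congr lebesgue_measure; apply/seteqP; split => c /=.
  by rewrite !in_itv/= lt_min => -[cq /andP[-> ->]].
by rewrite !in_itv/= lt_min => /andP[-> /andP[-> ->]].
Qed.

(** The variable is at most 0 and equals 0 with probability at least [a], so its quantiles at levels
    below [a] vanish. *)
Lemma ES_opp_indic {C : set T} {a : R} : measurable C -> 0 < a < 1 ->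
  fine (P C) <= 1 - a -> ES P a (fun w => - \1_C w) = 0%E.
Proof.
move=> mC a01 Ca; rewrite /ES.
rewrite (_ : \int[_]_(c in _) _ = 0)%E ?mule0//.
apply: integral0_eq => b; rewrite /= in_itv/= => /andP[b0 ba].
have b01 : 0 < b < 1 by case/andP: a01 => _ /(lt_trans ba) ->; rewrite b0.
have mI : measurable_fun setT (fun w => - \1_C w : R).
  by apply: measurable_funN; exact: measurable_indic.
congr EFin; apply/eqP; rewrite eq_le VaR_le//; apply/andP; split.
  rewrite [X in P X](_ : _ = set0) ?measure0 ?lee_fin ?(ltW b0)//.
  apply/seteqP; split => // w /=.
  by rewrite ltNge oppr_le0 indicE ler0n.
rewrite leNgt; apply/negP => v0.
have := lexx (VaR P b (fun w => - \1_C w)); rewrite VaR_le//; apply/negP.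
rewrite -ltNge; apply: (@lt_le_trans _ _ (P (~` C))).
  rewrite probability_setC// (probability_fineK P mC) -EFinB lte_fin; lra.
apply: le_measure; rewrite ?inE//.
- exact: measurableC.
- exact: measurable_gt_set.
by move=> w Cw /=; rewrite indicE memNset// oppr0.
Qed.

Lemma DQ_ES_range {n : nat} {a : R} : atomless P -> (2 <= n)%N -> 0 < a < 1 ->
  [set DQ_ES P a X | X in L1n P n] = [set x : R | 0 <= x <= 1].
Proof.
move=> atP n2 a01; have [a0 a1] := andP a01.
apply/seteqP; split => [_ [X L1X <-]|t /=]; rewrite /= /DQ_ES /DQ.
  have /andP[al0 _] := alpha_star_ge0_le1 (ES P) a X.
  rewrite (divr_ge0 al0 (ltW a0))/= ler_pdivrMr// mul1r.
  by apply: alpha_star_le => //; exact: ES_sum_le.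
move=> /andP[t0 t1].
(* p < a keeps ES_a(1_A) = p / a below 1; p <= 1 - a makes [ES_opp_indic] apply to subsets of
   [A]. *)
pose p := Num.min a (1 - a) / 2.
have [p0 pa pa1] : [/\ 0 < p, p < a & p <= 1 - a].
  by rewrite /p; case: (leP a (1 - a)) => h; split; lra.
have tp0 : 0 <= t * p by rewrite mulr_ge0// ltW.
have tpp : t * p <= p by rewrite ler_piMl// ltW.
have [|A [mA _ _ PA]] := atomless_between P atP (s := p) (@measurable0 _ T)
    measurableT (@subsetT _ _).
  rewrite measure0 probability_setT/=; lra.
have [|D [mD _ DA PD]] := atomless_between P atP (s := t * p) (@measurable0 _ T)
    mA (@sub0set _ _).
  by rewrite measure0 PA /= tp0.
have mC : measurable (A `\` D) by exact: measurableD.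
have PC : fine (P (A `\` D)) <= 1 - a.
  by rewrite fine_probabilityD// PA PD; lra.
case: n n2 => [//|[//|m]] _.
(* The first two coordinates add up to 1_D; the others are zero padding. *)
pose X (i : 'I_m.+2) : T -> R := match val i with
  | 0%N => \1_A | 1%N => fun w => - \1_(A `\` D) w | _ => \1_set0 end.
have sumX : (fun w => \sum_(i < m.+2) X i w) = \1_D.
  apply/funext => w; rewrite !big_ord_recl big1 /X/=; last first.
    by move=> i _; rewrite indic0.
  by rewrite indic_increment//; lra.
have sumES : (\sum_(i < m.+2) ES P a (X i) = (p / a)%:E)%E.
  rewrite !big_ord_recl big1 /X/=; last first.
    by move=> i _; rewrite ES_indic// measure0 /= mul0r min_r.
  rewrite ES_opp_indic// ES_indic// PA !adde0 min_r//.
  by rewrite ler_pdivrMr// mul1r ltW.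
exists X.
  move=> i; have mX : measurable_fun setT (X i).
    rewrite /X; case: (val i) => [|[|k]];
      [exact: measurable_indic| |exact: measurable_indic].
    by apply: measurable_funN; exact: measurable_indic.
  split => //; rewrite /X; case: (val i) => [|[|k]].
  - exact: integrable_indic.
  - by apply: (@integrableN _ _ _ P setT (fun w => (\1_(A `\` D) w)%:E));
      exact: integrable_indic.
  - exact: integrable_indic.
rewrite (@alpha_star_eq _ _ _ _ _ _ _ (t * a)) ?mulfK ?gt_eqF//.
  by rewrite mulr_ge0 ?(ltW a0)//= (le_trans _ (ltW a1))// ler_piMl// ltW.
move=> b b01; have [b0 _] := andP b01.
rewrite sumX sumES ES_indic// PD lee_fin ge_min.
(* Acceptance reads min(1, t p / b) <= p / a. Since p / a < 1, only t p / b <= p / a can hold, that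
   is t a <= b. *)
rewrite [1 <= _]leNgt ltr_pdivrMr// mul1r pa/=.
rewrite ler_pdivrMr// mulrAC ler_pdivlMr// [t * p]mulrC -mulrA.
by rewrite ler_pM2l.
Qed.

End es_range.

Theorem theorem1 (d : measure_display) (T : measurableType d) (R : realType)
  (P : probability T R) (n : nat) (a : R) :
  atomless P -> (2 <= n)%N -> 0 < a < 1 ->
  [set DQ_VaR P a X | X in L0n n] =
    [set x : R | 0 <= x <= Num.min (n%:R) a^-1]
  /\ [set DQ_ES P a X | X in L1n P n] = [set x : R | 0 <= x <= 1].
Proof.
move=> atP n2 a01; split; last exact: DQ_ES_range.
exact: (DQ_VaR_range P atP (ltnW n2) a01).
Qed.
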